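(* Let $P\subset \mathbb{F}_3^2\times\mathbb{F}_3^2$ be the set of all $((x_1,x_2),(y_1,y_2))$ satisfying $$x_1y_1^2+x_2y_2^2=0\quad\text{and}\quad x_1^2y_1+x_2^2y_2=0 .$$ Then $P$ is transverse but not bilinear.
   Context: Let $p$ be a prime and $n$ a positive integer. For $A\subset \mathbb{F}_p^n\times\mathbb{F}_p^n$ define the vertical sum $A\stackrel{V}{+}A=\{(x,y_1+y_2):(x,y_1),(x,y_2)\in A\}$ and the horizontal sum $A\stackrel{H}{+}A=\{(x_1+x_2,y):(x_1,y),(x_2,y)\in A\}$. The set $A$ is called transverse if $A\stackrel{V}{+}A=A\stackrel{H}{+}A=A$. The set $A$ is called bilinear if there exist linear subspaces $W_1,W_2\subseteq\mathbb{F}_p^n$, an integer $r\ge 0$ and bilinear forms $Q_1,\dots,Q_r$ on $W_1\times W_2$ such that $A=\{(x,y)\in W_1\times W_2: Q_1(x,y)=\cdots=Q_r(x,y)=0\}$. Here $p=3$ and $n=2$. *)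

(* Defs.v *)
From HB Require Import structures.
From mathcomp Require Import all_boot all_order all_algebra.

Set Implicit Arguments.
Unset Strict Implicit.
Unset Printing Implicit Defensive.

Import GRing.Theory.
Local Open Scope ring_scope.

Definition vsum (p n : nat) (A B : {set 'rV['F_p]_n * 'rV['F_p]_n}) :
    {set 'rV['F_p]_n * 'rV['F_p]_n} :=
  [set (a.1, a.2 + b.2) | a in A, b in B & a.1 == b.1].

Definition hsum (p n : nat) (A B : {set 'rV['F_p]_n * 'rV['F_p]_n}) :
    {set 'rV['F_p]_n * 'rV['F_p]_n} :=
  [set (a.1 + b.1, a.2) | a in A, b in B & a.2 == b.2].

Definition transverse (p n : nat) (A : {set 'rV['F_p]_n * 'rV['F_p]_n}) : Prop :=
  vsum A A = A /\ hsum A A = A.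

(* The forms are only defined on W1 x W2; [vsproj W] restricts to the bijection
   from W to [subvs_of W], and is used only on points already known to lie in
   W. *)
Definition bilinear_set (p n : nat) (A : {set 'rV['F_p]_n * 'rV['F_p]_n}) : Prop :=
  exists (W1 W2 : {vspace 'rV['F_p]_n}) (r : nat)
         (Q : 'I_r -> {bilinear subvs_of W1 -> subvs_of W2 -> 'F_p | *%R & *%R}),
    A = [set z | [&& z.1 \in W1, z.2 \in W2 &
                  [forall i, Q i (vsproj W1 z.1) (vsproj W2 z.2) == 0]]].

Definition cubicP : {set 'rV['F_3]_2 * 'rV['F_3]_2} :=
  [set z : 'rV['F_3]_2 * 'rV['F_3]_2 |
    let x1 := z.1 0 0 in let x2 := z.1 0 1 in
    let y1 := z.2 0 0 in let y2 := z.2 0 1 in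
    (x1 * y1 ^+ 2 + x2 * y2 ^+ 2 == 0) && (x1 ^+ 2 * y1 + x2 ^+ 2 * y2 == 0)].

(* Main.v *)
Require Import Defs.
From mathcomp Require Import all_boot all_order all_algebra.

(** For fixed [x], the two cubic equations cut out a linear subspace of vectors
    [y], although only the second one is linear in [y]: over the field with
    three elements, and modulo the second equation, the first one may be
    replaced by [x1 * x2 * (x1 + x2) * y1 = 0] ([cubic_fibre]).  Indeed, if
    [x1 * x2 = 0] the second equation already implies the first; otherwise both
    squares [x1 ^+ 2], [x2 ^+ 2] are [1], so [y2 = - y1] and the first equation
    reads [(x1 + x2) * y1 ^+ 2 = 0].  A set whose vertical fibres all contain
    [0] and are closed under addition equals its vertical sum; the set being
    invariant under exchanging [x] and [y], the horizontal sum follows.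

    The set is not bilinear, because bilinear equations have a rigidity which
    the cubic ones lack: a bilinear form that vanishes at [(u, v)], [(v, u)] and
    [(u - v, u - v)] also vanishes at [(u + v, u + v)], since
    [Q (u + v) (u + v) - Q (u - v) (u - v) = 2 * (Q u v + Q v u)]
    ([bilinear_set_polarization]).  For the standard basis vectors [u] and [v],
    the first three points satisfy the cubic equations and the fourth does
    not. *)

Set Implicit Arguments.
Unset Strict Implicit.
Unset Printing Implicit Defensive.

Import GRing.Theory.
Local Open Scope ring_scope.

Section Transversality.

Variables (p n : nat) (A : {set 'rV['F_p]_n * 'rV['F_p]_n}).

Lemma vsum_id :
  (forall x, (x, 0) \in A) ->
  (forall x y1 y2, (x, y1) \in A -> (x, y2) \in A -> (x, y1 + y2) \in A) ->
  vsum A A = A.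
Proof.
move=> A0 AD; apply/setP=> -[x y]; apply/imset2P/idP => [|Axy].
  case=> -[x1 y1] [x2 y2] A1; rewrite inE /= => /andP[A2 /eqP eqx] [-> ->].
  by apply: AD => //; rewrite eqx.
by exists (x, y) (x, 0); rewrite ?inE ?A0 ?eqxx //= addr0.
Qed.

Lemma hsum_id :
  (forall y, (0, y) \in A) ->
  (forall x1 x2 y, (x1, y) \in A -> (x2, y) \in A -> (x1 + x2, y) \in A) ->
  hsum A A = A.
Proof.
move=> A0 AD; apply/setP=> -[x y]; apply/imset2P/idP => [|Axy].
  case=> -[x1 y1] [x2 y2] A1; rewrite inE /= => /andP[A2 /eqP eqy] [-> ->].
  by apply: AD => //; rewrite eqy.
by exists (x, y) (0, y); rewrite ?inE ?A0 ?eqxx //= addr0.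
Qed.

(** Polarization: the two diagonal values [Q (u + v) (u + v)] and
    [Q (u - v) (u - v)] differ only by the cross terms. *)
Lemma bilinear_set_polarization (u v : 'rV['F_p]_n) :
  bilinear_set A ->
  (u, v) \in A -> (v, u) \in A -> (u - v, u - v) \in A ->
  (u + v, u + v) \in A.
Proof.
case=> W1 [W2 [r [Q ->]]]; rewrite !inE /=.
case/and3P=> u1 v2 /forallP Quv /and3P[v1 u2 /forallP Qvu].
case/and3P=> _ _ /forallP Qsub; rewrite !rpredD //=; apply/forallP=> i.
have:= Qsub i; rewrite !linearB !linearD /= !linearBl !linearDl.
by rewrite (eqP (Quv i)) (eqP (Qvu i)) subr0 sub0r opprK addr0 add0r.
Qed.

End Transversality.

(** The right-hand side is linear in [(y1, y2)]; the equality rests on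
    [a ^+ 2 = 1] for every nonzero [a], and is checked point by point. *)
Lemma cubic_fibre (x1 x2 y1 y2 : 'F_3) :
  (x1 * y1 ^+ 2 + x2 * y2 ^+ 2 == 0) && (x1 ^+ 2 * y1 + x2 ^+ 2 * y2 == 0) =
  (x1 * x2 * (x1 + x2) * y1 == 0) && (x1 ^+ 2 * y1 + x2 ^+ 2 * y2 == 0).
Proof.
move: x1 x2 y1 y2.
by do 4![case=> [[|[|[|//]]] ?]]; vm_compute.
Qed.

Lemma cubicP0 x : (x, 0) \in cubicP.
Proof. by rewrite inE /= !mxE expr0n !mulr0 addr0 eqxx. Qed.

Lemma cubicPD x y z :
  (x, y) \in cubicP -> (x, z) \in cubicP -> (x, y + z) \in cubicP.
Proof.
rewrite !inE /= !cubic_fibre !mxE.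
move=> /andP[/eqP y1 /eqP y2] /andP[/eqP z1 /eqP z2].
rewrite mulrDr y1 z1 addr0 eqxx /=.
by rewrite [x 0 0 ^+ 2 * _]mulrDr [x 0 1 ^+ 2 * _]mulrDr addrACA y2 z2 addr0.
Qed.

Lemma cubicP_swap x y : ((x, y) \in cubicP) = ((y, x) \in cubicP).
Proof.
by rewrite !inE /= andbC !(mulrC (_ ^+ 2)).
Qed.

Theorem proposition1p3 : transverse cubicP /\ ~ bilinear_set cubicP.
Proof.
split; first split.
- exact: vsum_id cubicP0 cubicPD.
- apply: hsum_id => [y | x1 x2 y]; first by rewrite cubicP_swap cubicP0.
  by rewrite ![(_, y) \in _]cubicP_swap; apply: cubicPD.
pose u : 'rV['F_3]_2 := delta_mx 0 0; pose v : 'rV['F_3]_2 := delta_mx 0 1.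
move=> /(@bilinear_set_polarization _ _ _ u v).
by rewrite !inE /= !mxE => /(_ isT isT isT).
Qed.
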